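(* Let $\Delta,\gamma\in(0,1)$ and let $d\ge4$ be an integer. There exist a positive semidefinite matrix $\boldsymbol{\Sigma}\in\mathbb{R}^{d\times d}$ with $(1-\gamma)\lambda_2(\boldsymbol{\Sigma})\ge\lambda_3(\boldsymbol{\Sigma})$, whose top two eigenvectors $\mathbf{v}_1,\mathbf{v}_2$ (unit eigenvectors for $\lambda_1(\boldsymbol\Sigma)$ and $\lambda_2(\boldsymbol\Sigma)$) are both supported on a common set of $2$ coordinates, and a unit vector $\mathbf{u}\in\mathbb{R}^d$ with at most $3$ nonzero entries and $\langle\mathbf{u},\mathbf{v}_1\rangle^2\ge1-\Delta$, such that, with $\mathbf{P}=\mathbf{I}_d-\mathbf{u}\mathbf{u}^\top$, the top eigenvector of $\mathbf{P}\boldsymbol{\Sigma}\mathbf{P}$ satisfies $$|\mathrm{supp}(\mathbf{v}_1(\mathbf{P}\boldsymbol{\Sigma}\mathbf{P}))|=d .$$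
   Context: $\lambda_i(\mathbf{M})$ is the $i$-th largest eigenvalue of a symmetric matrix $\mathbf{M}$, and $\mathbf{v}_i(\mathbf{M})$ a corresponding unit eigenvector; $\mathrm{supp}$ is the set of indices of nonzero entries of a vector. *)

(* Defs.v *)
From HB Require Import structures.
From mathcomp Require Import all_boot all_order all_algebra.
From mathcomp Require Import reals.
From mathcomp Require Import polyrcf.

Set Implicit Arguments.
Unset Strict Implicit.
Unset Printing Implicit Defensive.

Import Order.TTheory GRing.Theory Num.Theory.

Local Open Scope ring_scope.

Section Definitions.
Variables (R : realType) (d : nat).

(* [rootsR p] lists the distinct real roots of [p] in increasing order; each
   one is repeated here according to its algebraic multiplicity.  For a
   symmetric matrix this list has length [d]. *)
Definition eigvals (M : 'M[R]_d) : seq R :=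
  flatten [seq nseq (mup x (char_poly M)) x | x <- rev (rootsR (char_poly M))].

(* The index starts at 1: [eigval 1 M] is the largest eigenvalue. *)
Definition eigval (i : nat) (M : 'M[R]_d) : R := (eigvals M)`_i.-1.

Definition dotv (x y : 'cV[R]_d) : R := \sum_i x i 0 * y i 0.

Definition unitv (x : 'cV[R]_d) : Prop := dotv x x = 1.

(* [v] is a possible choice of the i-th unit eigenvector of [M]; such a [v] is
   determined up to sign only when [eigval i M] is a simple eigenvalue. *)
Definition unit_eigvec (i : nat) (M : 'M[R]_d) (v : 'cV[R]_d) : Prop :=
  unitv v /\ M *m v = eigval i M *: v.

Definition supp (x : 'cV[R]_d) : {set 'I_d} := [set i | x i 0 != 0].

Definition psd (M : 'M[R]_d) : Prop :=
  M^T = M /\ forall x : 'cV[R]_d, 0 <= dotv x (M *m x).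

End Definitions.

(* Main.v *)
Require Import Defs.
From mathcomp Require Import all_boot all_order all_algebra.
From mathcomp Require Import reals.
From mathcomp Require Import polyrcf ring lra.

Import Order.TTheory GRing.Theory Num.Theory.

Local Open Scope ring_scope.

(* Take Sigma = diag(l1, 1) + (beta J), a direct sum where J is the all-ones
   matrix of size N = d - 2 and N beta = 1 - gamma < 1; then v1 = e1, v2 = e2,
   and lambda_3 = N beta.  Let u = a e1 + c e2 + c e3 with a^2 = 1 - Delta and
   c^2 = Delta / 2.  If w is an eigenvector of P Sigma P for some
   lambda > N beta, then w is orthogonal to u and Sigma w = lambda w + k u.
   Here k <> 0, so the first two coordinates of w are nonzero; summing the
   other equations gives (lambda - N beta) s = - k c for the sum s of the
   remaining coordinates, so s <> 0, and beta J spreads s over all of them.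
   The value of l1 makes lambda = 2 an explicit eigenvalue of P Sigma P, so
   that its top eigenvalue is at least 2 > N beta. *)

(** * Real roots of a polynomial, listed with multiplicity in decreasing order *)

Section SortedRoots.
Set Implicit Arguments.
Unset Strict Implicit.
Context {R : rcfType}.
Implicit Types (p q : {poly R}) (x y : R).

(* [sroots (char_poly M)] is convertible to [eigvals M]. *)
Definition sroots p : seq R :=
  flatten [seq nseq (mup x p) x | x <- rev (rootsR p)].

Lemma mem_rootsR p x : p != 0 -> (x \in rootsR p) = root p x.
Proof. by move=> p0; rewrite -(roots_on_rootsR p0) in_itv. Qed.

Lemma count_sroots p x : p != 0 -> count_mem x (sroots p) = mup x p.
Proof.
move=> p0; rewrite count_flatten sumnE -map_comp big_map.
have [px|npx] := boolP (root p x); last first.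
  rewrite mupNroot // big1_seq // => y; rewrite mem_rev mem_rootsR // => py.
  rewrite /= count_nseq /=; case: eqP => [yx|]; last by rewrite mul0n.
  by rewrite yx (negPf npx) in py.
rewrite (bigD1_seq x) /= ?mem_rev ?mem_rootsR ?rev_uniq ?uniq_roots //.
rewrite count_nseq /= eqxx mul1n big1 ?addn0 // => y /negPf yx.
by rewrite count_nseq /= yx mul0n.
Qed.

Lemma mem_sroots p x : p != 0 -> (x \in sroots p) = root p x.
Proof.
move=> p0; rewrite -has_pred1 has_count count_sroots // -XsubC_dvd //.
by rewrite dvdp_XsubCl.
Qed.

Lemma sorted_sroots p : sorted >=%R (sroots p).
Proof.
rewrite sorted_pairwise; last exact: ge_trans.
have: sorted >%R (rev (rootsR p)) by rewrite rev_sorted sorted_roots.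
rewrite /sroots sorted_pairwise; last by move=> y x z xy /lt_trans; apply.
elim: (rev _) => //= x s IHs /andP[/allP xs /IHs {}IHs].
rewrite pairwise_cat IHs andbT; apply/andP; split.
  apply/allrelP => y z /nseqP[-> _] /flatten_mapP[t /xs tx /nseqP[-> _]].
  exact: ltW.
by elim: (mup x p) => //= k ->; rewrite andbT all_nseq /= lexx orbT.
Qed.

(** Two sorted lists with the same multiplicities coincide. This lets the eigenvalues of a block
    diagonal matrix be peeled off from the top, one linear factor at a time. *)
Lemma sroots_MXsubC p x :
  p != 0 -> (forall y, root p y -> y <= x) ->
  sroots (('X - x%:P) * p) = x :: sroots p.
Proof.
move=> p0 px; have xp0 : ('X - x%:P) * p != 0.
  by rewrite mulf_neq0 ?polyXsubC_eq0.
apply: (sorted_eq (leT := >=%R)); first exact: ge_trans.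
- by move=> y z; rewrite /= andbC; apply: le_anti.
- exact: sorted_sroots.
- rewrite /= path_min_sorted ?sorted_sroots //.
  by apply/allP => y; rewrite mem_sroots //; apply: px.
- apply/allP => y _ /=; rewrite !count_sroots // mupM ?polyXsubC_eq0 //.
  by rewrite (@mup_XsubCX _ 1); case: eqP.
Qed.

Lemma root_le_sroots0 p x : p != 0 -> root p x -> x <= (sroots p)`_0.
Proof.
move=> p0; rewrite -mem_sroots //; have := sorted_sroots p.
case: (sroots p) => // y s /=; rewrite path_sortedE; last exact: ge_trans.
by move=> /andP[/allP ys _]; rewrite inE => /predU1P[-> //|/ys].
Qed.

End SortedRoots.

(** * Bounds on eigenvalues *)

Section Eigenvalues.
Set Implicit Arguments.
Unset Strict Implicit.
Context {R : realType}.

(** [eigenvalue] concerns row vectors, so symmetry of [M] is used to transpose the column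
    equation. *)
Lemma sym_root_char_poly n (M : 'M[R]_n) (v : 'cV_n) x :
  M^T = M -> v != 0 -> M *m v = x *: v -> root (char_poly M) x.
Proof.
move=> Ms v0 Mv; rewrite -eigenvalue_root_char; apply/eigenvalueP.
exists v^T; last by rewrite -trmx0 (inj_eq trmx_inj).
by rewrite -{1}Ms -trmx_mul Mv linearZ.
Qed.

Lemma eigval1_ge n (M : 'M[R]_n) (v : 'cV_n) x :
  M^T = M -> v != 0 -> M *m v = x *: v -> x <= eigval 1 M.
Proof.
move=> Ms v0 Mv; apply: root_le_sroots0.
  exact/monic_neq0/char_poly_monic.
exact: sym_root_char_poly Ms v0 Mv.
Qed.

(** Every entry of [x v] equals [b] times the sum of [v]. If that sum vanishes then [x = 0];
    otherwise adding up the entries gives [x = n b]. *)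
Lemma char_poly_const_mx_le n (b x : R) :
  0 <= b -> root (char_poly (const_mx b : 'M_n)) x -> x <= n%:R * b.
Proof.
move=> b0; rewrite -eigenvalue_root_char => /eigenvalueP[v vb v0].
have vE j : b * (\sum_k v 0 k) = x * v 0 j.
  move/rowP: vb => /(_ j); rewrite !mxE => <-.
  by rewrite mulr_sumr; apply: eq_bigr => k _; rewrite !mxE mulrC.
have [s0|s0] := eqVneq (\sum_k v 0 k) 0.
  have [j vj] : exists j, v 0 j != 0 by apply/rV0Pn.
  have /eqP := vE j; rewrite s0 mulr0 eq_sym mulf_eq0 (negPf vj) orbF.
  by move/eqP->; rewrite mulr_ge0.
suff -> : x = n%:R * b by [].
apply: (mulIf s0); rewrite mulr_sumr.
rewrite -(eq_bigr _ (fun j _ => vE j)) sumr_const card_ord.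
by rewrite -mulrA mulr_natl.
Qed.

End Eigenvalues.

(** * Spectrum and eigenvectors of the matrix before deflation *)

Section Spiked.
Set Implicit Arguments.
Unset Strict Implicit.
Context {R : realType} {n : nat}.
Implicit Types (l beta x : R) (v w : 'cV[R]_(1 + (1 + n))).

Definition fst_idx : 'I_(1 + (1 + n)) := lshift (1 + n) 0.
Definition snd_idx : 'I_(1 + (1 + n)) := rshift 1 (lshift n 0).
Definition tail_idx (j : 'I_n) : 'I_(1 + (1 + n)) := rshift 1 (rshift 1 j).

Definition spiked l1 l2 beta : 'M[R]_(1 + (1 + n)) :=
  block_mx l1%:M 0 0 (block_mx l2%:M 0 0 (const_mx beta)).

Definition spiked_col (a b : R) (y : 'cV[R]_n) : 'cV[R]_(1 + (1 + n)) :=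
  col_mx a%:M (col_mx b%:M y).

Lemma spiked_ind (P : 'I_(1 + (1 + n)) -> Prop) :
  P fst_idx -> P snd_idx -> (forall j, P (tail_idx j)) -> forall i, P i.
Proof.
move=> P0 P1 Pt i; rewrite -(splitK i); case: (split i) => j /=.
  by rewrite ord1.
rewrite -(splitK j); case: (split j) => k /=; first by rewrite ord1.
exact: Pt.
Qed.

Lemma spiked_sum (F : 'I_(1 + (1 + n)) -> R) :
  \sum_i F i = F fst_idx + F snd_idx + \sum_j F (tail_idx j).
Proof. by rewrite !big_split_ord /= !big_ord1 addrA. Qed.

Lemma spiked_dotv v w :
  dotv v w = v fst_idx 0 * w fst_idx 0 + v snd_idx 0 * w snd_idx 0 +
             \sum_j v (tail_idx j) 0 * w (tail_idx j) 0.
Proof. exact: spiked_sum. Qed.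

Lemma spiked_col0 a b y : spiked_col a b y fst_idx 0 = a.
Proof. by rewrite col_mxEu mxE. Qed.

Lemma spiked_col1 a b y : spiked_col a b y snd_idx 0 = b.
Proof. by rewrite col_mxEd col_mxEu mxE. Qed.

Lemma spiked_colt a b y j : spiked_col a b y (tail_idx j) 0 = y j 0.
Proof. by rewrite !col_mxEd. Qed.

Definition spiked_colE := (spiked_col0, spiked_col1, spiked_colt).

Lemma spiked_mul l1 l2 beta v : spiked l1 l2 beta *m v =
  spiked_col (l1 * v fst_idx 0) (l2 * v snd_idx 0)
    (const_mx (beta * \sum_j v (tail_idx j) 0)).
Proof.
apply/colP; apply: spiked_ind => [||j]; rewrite spiked_colE !mxE.
- rewrite spiked_sum !(block_mxEul, block_mxEur, mxE) !mul0r addr0 big1.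
    by rewrite addr0.
  by move=> j _; rewrite !(block_mxEul, block_mxEur, mxE) mul0r.
- rewrite spiked_sum !(block_mxEul, block_mxEur, block_mxEdr, block_mxEdl, mxE).
  rewrite mul0r add0r big1 ?addr0 // => j _.
  by rewrite !(block_mxEdr, block_mxEur, mxE) mul0r.
- rewrite spiked_sum !(block_mxEul, block_mxEur, block_mxEdr, block_mxEdl, mxE).
  rewrite !mul0r !add0r mulr_sumr; apply: eq_bigr => k _.
  by rewrite !(block_mxEdr, block_mxEur, mxE).
Qed.

Lemma spiked_sym l1 l2 beta : (spiked l1 l2 beta)^T = spiked l1 l2 beta.
Proof. by rewrite /spiked !tr_block_mx !tr_scalar_mx trmx_const !trmx0. Qed.

(** The quadratic form is [l1 v_1^2 + l2 v_2^2 + beta s^2], where [s] is the sum of the tail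
    coordinates. *)
Lemma spiked_psd l1 l2 beta :
  0 <= l1 -> 0 <= l2 -> 0 <= beta -> psd (spiked l1 l2 beta).
Proof.
move=> l1_ge0 l2_ge0 beta_ge0; split=> [|v]; first exact: spiked_sym.
rewrite spiked_dotv spiked_mul !spiked_colE.
rewrite (eq_bigr (fun j => v (tail_idx j) 0 *
                           (beta * \sum_k v (tail_idx k) 0))); last first.
  by move=> j _; rewrite spiked_colE mxE.
rewrite -mulr_suml; set s := \sum_j _.
rewrite (mulrCA _ l1) (mulrCA _ l2) (mulrCA s) -!expr2.
by rewrite !addr_ge0 // mulr_ge0 // sqr_ge0.
Qed.

(** The characteristic polynomial factors along the blocks, and the hypotheses place [l2], then
    [l1], above all remaining roots. *)
Lemma eigvals_spiked l1 l2 beta :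
  0 <= beta -> n%:R * beta <= l2 -> l2 <= l1 ->
  eigvals (spiked l1 l2 beta) =
  [:: l1, l2 & eigvals (const_mx beta : 'M_n)].
Proof.
move=> beta_ge0 tl2 l21.
have cpE (m : nat) (c : R) (B : 'M[R]_m) :
    char_poly (block_mx (c%:M : 'M_1) 0 0 B) = ('X - c%:P) * char_poly B.
  rewrite {1}/char_poly char_block_diag_mx det_ublock; congr (_ * _).
  by rewrite det_mx11 !mxE eqxx.
have q0 : char_poly (const_mx beta : 'M_n) != 0.
  exact/monic_neq0/char_poly_monic.
have qr y : root (char_poly (const_mx beta : 'M_n)) y -> y <= l2.
  by move=> /(char_poly_const_mx_le beta_ge0) /le_trans; apply.
rewrite /eigvals !cpE -/(sroots _) sroots_MXsubC ?sroots_MXsubC //.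
  by rewrite mulf_neq0 ?polyXsubC_eq0.
move=> y; rewrite rootM root_XsubC => /orP[/eqP-> //|/qr yl2].
exact: le_trans yl2 l21.
Qed.

Lemma eigval3_spiked_le l1 l2 beta :
  0 <= beta -> n%:R * beta <= l2 -> l2 <= l1 ->
  eigval 3 (spiked l1 l2 beta) <= n%:R * beta.
Proof.
move=> beta_ge0 tl2 l21; rewrite /eigval eigvals_spiked //=.
have q0 : char_poly (const_mx beta : 'M_n) != 0.
  exact/monic_neq0/char_poly_monic.
(* On an empty list the lookup returns the default 0, which also satisfies the bound; the length of
   the list is thus never computed. *)
case E: (eigvals _) => [|y s] /=; first by rewrite mulr_ge0.
apply: char_poly_const_mx_le => //.
by rewrite -mem_sroots // -[sroots _]/(eigvals _) E mem_head.
Qed.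

(** Each tail equation reads [beta s = x v_j]. Their sum is [(x - n beta) s = 0], so [s = 0], and
    then every [v_j] vanishes since [x] is positive. *)
Lemma spiked_eigvec_tail l1 l2 beta v x :
  0 <= beta -> n%:R * beta < x -> spiked l1 l2 beta *m v = x *: v ->
  forall j, v (tail_idx j) 0 = 0.
Proof.
move=> beta_ge0 xgt; rewrite spiked_mul => /colP vE.
have x0 : x != 0 by rewrite gt_eqF // (le_lt_trans _ xgt) // mulr_ge0.
set s := \sum_j v (tail_idx j) 0 in vE.
have vt j : beta * s = x * v (tail_idx j) 0.
  by have := vE (tail_idx j); rewrite spiked_colE !mxE.
suff s0 : s = 0.
  by move=> j; apply: (mulfI x0); rewrite -vt s0 !mulr0.
have: (x - n%:R * beta) * s = 0.
  rewrite mulrBl {1}/s mulr_sumr -(eq_bigr _ (fun j _ => vt j)).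
  by rewrite sumr_const card_ord -mulrA mulr_natl subrr.
by move/eqP; rewrite mulf_eq0 subr_eq0 gt_eqF //= => /eqP.
Qed.

Lemma spiked_eigvec1 l1 l2 beta v :
  0 <= beta -> n%:R * beta < l1 -> l1 != l2 ->
  spiked l1 l2 beta *m v = l1 *: v ->
  v snd_idx 0 = 0 /\ forall j, v (tail_idx j) 0 = 0.
Proof.
move=> beta_ge0 l1gt l12 vE; split; last exact: spiked_eigvec_tail vE.
move: vE; rewrite spiked_mul => /colP /(_ snd_idx); rewrite spiked_colE mxE => /eqP.
by rewrite -subr_eq0 -mulrBl mulf_eq0 subr_eq0 eq_sym (negPf l12) => /eqP.
Qed.

Lemma spiked_eigvec2 l1 l2 beta v :
  0 <= beta -> n%:R * beta < l2 -> l1 != l2 ->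
  spiked l1 l2 beta *m v = l2 *: v ->
  v fst_idx 0 = 0 /\ forall j, v (tail_idx j) 0 = 0.
Proof.
move=> beta_ge0 l2gt l12 vE; split; last exact: spiked_eigvec_tail vE.
move: vE; rewrite spiked_mul => /colP /(_ fst_idx); rewrite spiked_colE mxE => /eqP.
by rewrite -subr_eq0 -mulrBl mulf_eq0 subr_eq0 (negPf l12) => /eqP.
Qed.

End Spiked.

(** * Eigenvectors after projecting out a unit vector *)

Section Deflation.
Set Implicit Arguments.
Unset Strict Implicit.
Context {R : realType}.

Lemma dotvE d (x y : 'cV[R]_d) : x^T *m y = (dotv x y)%:M.
Proof.
rewrite [LHS]mx11_scalar mxE; congr (_%:M).
by apply: eq_bigr => i _; rewrite mxE.
Qed.

Lemma deflationE d (u x : 'cV[R]_d) :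
  (1%:M - u *m u^T) *m x = x - dotv u x *: u.
Proof.
by rewrite mulmxBl mul1mx -mulmxA dotvE mul_mx_scalar.
Qed.

Lemma deflation_sym d (u : 'cV[R]_d) (M : 'M[R]_d) :
  M^T = M ->
  ((1%:M - u *m u^T) *m M *m (1%:M - u *m u^T))^T =
  (1%:M - u *m u^T) *m M *m (1%:M - u *m u^T).
Proof.
move=> Ms; rewrite !trmx_mul Ms linearB /= trmx1 trmx_mul trmxK.
by rewrite mulmxA.
Qed.

Lemma dotvB d (u x y : 'cV[R]_d) : dotv u (x - y) = dotv u x - dotv u y.
Proof. by rewrite -sumrB; apply: eq_bigr => i _; rewrite !mxE mulrBr. Qed.

Lemma dotvZ d k (u x : 'cV[R]_d) : dotv u (k *: x) = k * dotv u x.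
Proof. by rewrite mulr_sumr; apply: eq_bigr => i _; rewrite !mxE mulrCA. Qed.

Lemma deflation_eigvec d (u w : 'cV[R]_d) (M : 'M[R]_d) x :
  unitv u -> dotv u w = 0 -> M *m w = x *: w + u ->
  (1%:M - u *m u^T) *m M *m (1%:M - u *m u^T) *m w = x *: w.
Proof.
move=> u1 uw Mw.
have Pw : (1%:M - u *m u^T) *m w = w by rewrite deflationE uw scale0r subr0.
rewrite -!mulmxA Pw Mw mulmxDr -scalemxAr Pw deflationE u1 scale1r subrr.
exact: addr0.
Qed.

(** The range of the projection is orthogonal to [u], hence so is [x w], and [x] can be cancelled.
    The projection then fixes [w], and [k] is the component of [M w] along [u] that it removes. *)
Lemma deflation_eigvec_inv d (u w : 'cV[R]_d) (M : 'M[R]_d) x :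
  unitv u -> x != 0 ->
  (1%:M - u *m u^T) *m M *m (1%:M - u *m u^T) *m w = x *: w ->
  dotv u w = 0 /\ exists k, M *m w = x *: w + k *: u.
Proof.
move=> u1 x0 wE; have uw : dotv u w = 0.
  apply: (mulfI x0); rewrite -dotvZ -wE -!mulmxA deflationE dotvB dotvZ u1.
  by rewrite mulr1 subrr mulr0.
split=> //; exists (dotv u (M *m w)).
have Pw : (1%:M - u *m u^T) *m w = w by rewrite deflationE uw scale0r subr0.
by rewrite -wE -!mulmxA Pw deflationE subrK.
Qed.

Context {n : nat}.

(** The value [x] is arbitrary above the tail eigenvalue, so that this applies to the top eigenvalue
    of the deflated matrix without computing it. *)
Lemma deflated_spiked_full (l1 l2 beta a b c x : R)
    (w : 'cV[R]_(1 + (1 + n.+1))) :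
  let u := spiked_col a b (c *: delta_mx 0 0) in
  0 < beta -> n.+1%:R * beta < x -> l1 != l2 -> a != 0 -> b != 0 -> c != 0 ->
  w != 0 -> dotv u w = 0 ->
  (exists k, spiked l1 l2 beta *m w = x *: w + k *: u) ->
  forall i, w i 0 != 0.
Proof.
move=> u beta0 xgt l12 a0 b0 c0 w0 uw [k wE].
have x0 : 0 < x by rewrite (le_lt_trans _ xgt) // mulr_ge0 // ltW.
(* Otherwise [w] is an eigenvector of the undeflated matrix, hence a multiple
   of one of the first two basis vectors, and these are not orthogonal to [u]. *)
have k0 : k != 0.
  apply: contraNneq w0 => k0; move: wE; rewrite k0 scale0r addr0 => wE.
  have wt := spiked_eigvec_tail (ltW beta0) xgt wE.
  move: wE uw; rewrite spiked_mul => /colP wE.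
  have := wE fst_idx; have := wE snd_idx; rewrite !spiked_colE !mxE => w1 w0.
  rewrite spiked_dotv big1 ?addr0; last by move=> j _; rewrite wt mulr0.
  rewrite !spiked_colE => uw.
  have {}w1 : w snd_idx 0 = 0.
    apply/eqP; move: w1 => /eqP; rewrite -subr_eq0 -mulrBl mulf_eq0.
    case/orP => // /eqP l2x; move: w0 => /eqP.
    rewrite -subr_eq0 -mulrBl mulf_eq0 => /orP[/eqP l1x|/eqP w0].
      by case/eqP: l12; lra.
    move: uw => /eqP; rewrite w0 mulr0 add0r mulf_eq0.
    by rewrite (negPf b0).
  have {}w0 : w fst_idx 0 = 0.
    by apply/eqP; move: uw => /eqP; rewrite w1 mulr0 addr0 mulf_eq0 (negPf a0).
  by apply/eqP/colP; apply: spiked_ind => [||j]; rewrite ?w0 ?w1 ?wt mxE.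
set s := \sum_j w (tail_idx j) 0.
have {}wE i : spiked_col (l1 * w fst_idx 0) (l2 * w snd_idx 0)
      (const_mx (beta * s)) i 0 =
    x * w i 0 + k * u i 0.
  rewrite -spiked_mul wE [LHS]mxE; congr (_ + _); exact: mxE.
have wt j : x * w (tail_idx j) 0 = beta * s - k * c * (j == 0)%:R.
  have := wE (tail_idx j); rewrite !spiked_colE !mxE andbT => ->; ring.
have sE : (x - n.+1%:R * beta) * s = - (k * c).
  rewrite mulrBl {1}/s mulr_sumr (eq_bigr _ (fun j _ => wt j)).
  rewrite sumrB sumr_const card_ord -mulrA mulr_natl.
  rewrite (bigD1 ord0) //= big1 ?addr0; last by move=> j /negPf ->; rewrite mulr0.
  by rewrite mulr1 addrAC subrr add0r.
have s0 : s != 0.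
  apply/eqP => s0; move/eqP: sE; rewrite s0 mulr0 eq_sym oppr_eq0 mulf_eq0.
  by rewrite (negPf k0) (negPf c0).
apply: spiked_ind => [||j]; apply/eqP => wi0.
- have /eqP := wE fst_idx; rewrite !spiked_colE wi0 !mulr0 add0r eq_sym mulf_eq0.
  by rewrite (negPf k0) (negPf a0).
- have /eqP := wE snd_idx; rewrite !spiked_colE wi0 !mulr0 add0r eq_sym mulf_eq0.
  by rewrite (negPf k0) (negPf b0).
(* The tail coordinate met by [u] is the delicate one: there [sE] turns [beta s - k c] into
   [(x - n beta) s], nonzero because [x] exceeds even [(n + 1) beta]. Elsewhere the right side is
   just [beta s]. *)
have := wt j; rewrite wi0 mulr0; case: (j == 0).
  have -> : beta * s - k * c * 1 = (x - n%:R * beta) * s.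
    by rewrite mulr1 -sE -natr1; ring.
  move/esym/eqP; rewrite mulf_eq0 (negPf s0) orbF subr_eq0 gt_eqF //.
  by apply: le_lt_trans xgt; rewrite ler_pM2r // ler_nat.
move/esym/eqP; rewrite mulr0 subr0 mulf_eq0 (negPf s0) orbF.
by rewrite gt_eqF.
Qed.

End Deflation.

(** * Choice of the parameters and verification of the claims *)

Theorem lemma11 (R : realType) (Delta gamma : R) (d : nat)
    (hDelta : 0 < Delta < 1) (hgamma : 0 < gamma < 1) (hd : (4 <= d)%N) :
  exists (Sigma : 'M[R]_d) (S : {set 'I_d}) (u : 'cV[R]_d),
    [/\ psd Sigma,
        (1 - gamma) * eigval 2 Sigma >= eigval 3 Sigma
      & #|S| = 2%N] /\
    [/\ unitv u,
        (#|supp u| <= 3)%N,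
        (forall v1 : 'cV[R]_d, unit_eigvec 1 Sigma v1 ->
           supp v1 \subset S /\ dotv u v1 ^+ 2 >= 1 - Delta),
        (forall v2 : 'cV[R]_d, unit_eigvec 2 Sigma v2 -> supp v2 \subset S)
      & let P := 1%:M - u *m u^T in
        forall w : 'cV[R]_d, unit_eigvec 1 (P *m Sigma *m P) w ->
          #|supp w| = d].
Proof.
have [n ->] : exists n, d = (1 + (1 + n.+1))%N.
  by exists (d - 3)%N; rewrite !add1n -[in LHS](subnK (ltnW hd)) addn3.
case/andP: hDelta => D0 D1; case/andP: hgamma => g0 g1.
(* The tail block then has top eigenvalue [1 - gamma], exactly the gap allowed below a second
   eigenvalue equal to 1. *)
pose beta : R := (1 - gamma) / n.+1%:R.
have nbeta : n.+1%:R * beta = 1 - gamma by rewrite mulrC divfK // pnatr_eq0.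
have beta0 : 0 < beta by rewrite divr_gt0 ?subr_gt0 ?ltr0n.
(* Since [a^2 + 2 c^2 = 1], the vector with entries [a, c, c] is a unit vector. *)
pose a : R := Num.sqrt (1 - Delta); pose c : R := Num.sqrt (Delta / 2).
have a2 : a ^+ 2 = 1 - Delta by rewrite sqr_sqrtr // subr_ge0 ltW.
have c2 : c ^+ 2 = Delta / 2 by rewrite sqr_sqrtr // divr_ge0 // ltW.
have a_gt0 : 0 < a by rewrite sqrtr_gt0 subr_gt0.
have c_gt0 : 0 < c by rewrite sqrtr_gt0 divr_gt0.
have a0 : a != 0 by rewrite gt_eqF.
have c0 : c != 0 by rewrite gt_eqF.
(* This [r] solves [beta (1 + (n + 1) r) = 2 r], the tail equation for the eigenvalue 2. *)
pose r := beta / (1 + gamma).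
have r0 : 0 < r by rewrite divr_gt0 // addr_gt0.
have nr : n.+1%:R * r = (1 - gamma) / (1 + gamma) by rewrite mulrA nbeta.
(* [m + 2] is the first eigenvalue; [m] solves the secular equation
   [a^2 / m = c^2 + c^2 (1 + r) / 2], which makes [2] an eigenvalue of the
   deflated matrix. *)
pose m : R := a ^+ 2 / (c ^+ 2 * (1 + (1 + r) / 2)).
have m0 : 0 < m by rewrite divr_gt0 ?mulr_gt0 //; lra.
have mE : a ^+ 2 / m = c ^+ 2 * (1 + (1 + r) / 2).
  rewrite /m invf_div mulrCA divff ?mulr1 //; exact: expf_neq0.
have l12 : m + 2 != 1 by rewrite gt_eqF //; lra.
pose Sigma : 'M[R]_(1 + (1 + n.+1)) := spiked (m + 2) 1 beta.
pose u : 'cV[R]_(1 + (1 + n.+1)) := spiked_col a c (c *: delta_mx 0 0).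
have u_supp : supp u \subset [set fst_idx; snd_idx; tail_idx 0].
  apply/subsetP; apply: spiked_ind => [||j]; rewrite !inE ?eqxx ?orbT //.
  rewrite spiked_colE !mxE andbT.
  by have [->|_] := eqVneq j 0; rewrite ?eqxx ?orbT // mulr0 eqxx.
have usum (f : 'I_n.+1 -> R) : \sum_j u (tail_idx j) 0 * f j = c * f 0.
  rewrite (bigD1 ord0) //= big1 => [|j /negPf j0].
    by rewrite spiked_colE !mxE eqxx mulr1 addr0.
  by rewrite spiked_colE !mxE j0 mulr0 mul0r.
have u1 : unitv u.
  rewrite /unitv spiked_dotv usum !spiked_colE !mxE eqxx mulr1 -!expr2 a2 c2.
  by lra.
have nb1 : n.+1%:R * beta <= 1 by lra.
have l21 : 1 <= m + 2 by lra.
have ev := eigvals_spiked (ltW beta0) nb1 l21.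
have supp01 (v : 'cV[R]_(1 + (1 + n.+1))) :
    (forall j, v (tail_idx j) 0 = 0) -> supp v \subset [set fst_idx; snd_idx].
  move=> vt; apply/subsetP; apply: spiked_ind => [||j].
  - by rewrite !inE eqxx.
  - by rewrite !inE eqxx orbT.
  - by rewrite !inE vt eqxx.
exists Sigma, [set fst_idx; snd_idx], u; split; split=> //.
- by apply: spiked_psd; lra.
- have -> : eigval 2 Sigma = 1 by rewrite /eigval ev.
  by rewrite mulr1 -nbeta; apply: eigval3_spiked_le => //; exact: ltW.
- by rewrite cards2.
- apply: leq_trans (subset_leq_card u_supp) _.
  by rewrite setUC cardsU1 cards2; case: (_ \notin _).
- move=> v [v1]; rewrite {1}/eigval ev /= => vE.
  have [|v_1 v_t] := spiked_eigvec1 (ltW beta0) _ l12 vE; first by lra.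
  split; first exact: supp01.
  (* Only the first coordinate of [v] survives and its square is 1, so the squared inner product is
     exactly [a^2]. *)
  move: v1; rewrite /unitv !spiked_dotv usum v_1 v_t !mulr0 !addr0 spiked_colE.
  rewrite big1 => [|j _]; last by rewrite v_t mulr0.
  by rewrite addr0 -expr2 exprMn a2 => ->; rewrite mulr1.
- move=> v [v1]; rewrite {1}/eigval ev /= => vE.
  have [|v_0 v_t] := spiked_eigvec2 (ltW beta0) _ l12 vE; first by lra.
  exact: supp01.
- move=> P w [w1 wE].
  have lam : 2 <= eigval 1 (P *m Sigma *m P).
    (* Solving [Sigma z = 2 z + u] coordinatewise yields this [z]; its orthogonality to [u] is the
       secular equation [mE]. *)
    pose z : 'cV[R]_(1 + (1 + n.+1)) := spiked_col (a / m) (- c)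
      (\col_j (- (c / 2) * ((j == 0)%:R + r))).
    have z0 : z != 0.
      apply: contraNneq c0 => /colP /(_ snd_idx).
      by rewrite spiked_colE mxE => /eqP; rewrite oppr_eq0.
    apply: (@eigval1_ge _ _ _ z) => //.
      by apply: deflation_sym; apply: spiked_sym.
    apply: deflation_eigvec => //.
      rewrite spiked_dotv usum !spiked_colE !mxE eqxx.
      by rewrite mulrA -expr2 mE /=; field.
    have zsum : \sum_j z (tail_idx j) 0 = - (c / 2) * (1 + n.+1%:R * r).
      rewrite (eq_bigr (fun j => - (c / 2) * ((j == 0)%:R + r))); last first.
        by move=> j _; rewrite spiked_colE mxE.
      rewrite -mulr_sumr big_split /= sumr_const card_ord -[r *+ _]mulr_natl.
      rewrite (bigD1 ord0) //= big1 => [|j /negPf ->] //.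
      by rewrite addr0.
    rewrite spiked_mul zsum nr; apply/colP => i.
    rewrite [RHS]mxE [X in _ = X + _]mxE; move: i.
    apply: spiked_ind => [||j]; rewrite !spiked_colE ?mxE.
    - by field; rewrite gt_eqF.
    - by ring.
    - by rewrite andbT /r; field; rewrite gt_eqF // addr_gt0.
  have lam0 : eigval 1 (P *m Sigma *m P) != 0 by rewrite gt_eqF //; lra.
  have [uw kE] := deflation_eigvec_inv u1 lam0 wE.
  have w0 : w != 0.
    apply/eqP => w0; move: w1; rewrite /unitv w0 /dotv big1.
      by move/eqP; rewrite eq_sym oner_eq0.
    by move=> j _; rewrite mxE mulr0.
  have full : forall i, w i 0 != 0.
    have tail_lt : n.+1%:R * beta < eigval 1 (P *m Sigma *m P) by lra.
    exact: (deflated_spiked_full beta0 tail_lt l12 a0 c0 c0 w0 uw kE).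
  by rewrite -[RHS]card_ord -cardsT; apply: eq_card => i; rewrite !inE full.
Qed.
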